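(* Let $\Gamma$ be a finite connected simple graph with $r+1$ vertices and $n$ edges, where $r\ge 2$, let $F_\Gamma\in\mathbb{R}[x_1,\dots,x_n]$ be its Kirchhoff polynomial, and let $R_\Gamma^*=\bigoplus_{\ell=0}^r R_\Gamma^\ell=\mathbb{R}[x_1,\dots,x_n]/\mathrm{Ann}(F_\Gamma)$. For $\boldsymbol{a}=(a_1,\dots,a_n)\in(\mathbb{R}_{>0})^n$ let $L_{\boldsymbol{a}}=a_1x_1+\cdots+a_nx_n\in R_\Gamma^1$. Then for every $\boldsymbol{a}\in(\mathbb{R}_{>0})^n$, the Hodge--Riemann bilinear form $$Q_{L_{\boldsymbol{a}}}^1: R_\Gamma^1\times R_\Gamma^1\to\mathbb{R},\qquad (\xi_1,\xi_2)\mapsto[\xi_1L_{\boldsymbol{a}}^{r-2}\xi_2]$$ is non-degenerate, where $[-]:R_\Gamma^r\to\mathbb{R}$ is the isomorphism $P\mapsto P\left(\frac{\partial}{\partial x_1},\dots,\frac{\partial}{\partial x_n}\right)F_\Gamma$. Moreover, $Q_{L_{\boldsymbol{a}}}^1$ has $n-1$ negative eigenvalues and one positive eigenvalue.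
   Context: For a finite connected graph $\Gamma=(V,E)$ with edges labelled $1,\dots,n$, the Kirchhoff polynomial is $F_\Gamma(x_1,\dots,x_n)=\sum_{T}\prod_{i\in T}x_i$, the sum over all spanning trees $T$ of $\Gamma$ (identified with their edge sets). For a homogeneous polynomial $F\in\mathbb{R}[x_1,\dots,x_n]$, $\mathrm{Ann}(F)=\{P\in\mathbb{R}[x_1,\dots,x_n] : P(\frac{\partial}{\partial x_1},\dots,\frac{\partial}{\partial x_n})F=0\}$, a homogeneous ideal; the quotient is graded by degree, and $R_\Gamma^\ell$ denotes its degree-$\ell$ part. The eigenvalue signs of a symmetric bilinear form are those of its Gram matrix in any basis (i.e. its signature), counted with multiplicity. *)

(* Defs.v *)
From HB Require Import structures.
From mathcomp Require Import all_boot all_order all_algebra.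
From mathcomp Require Import ring_quotient generic_quotient.
From mathcomp Require Import ssrcomplements mpoly reals.

Set Implicit Arguments.
Unset Strict Implicit.
Unset Printing Implicit Defensive.

Import Order.TTheory GRing.Theory Num.Theory.
Local Open Scope ring_scope.
Local Open Scope quotient_scope.

(* A simple graph on V whose edges are labelled by 'I_n: no loop by edge_card, *)
(* no multiple edge by edge_inj.                                               *)
Record sgraph (V : finType) (n : nat) := SGraph {
  edge :> 'I_n -> {set V};
  edge_card : forall i, #|edge i| = 2%N;
  edge_inj : injective edge
}.

Section Kirchhoff.
Variables (V : finType) (n : nat) (G : sgraph V n).
Implicit Types T : {set 'I_n}.

Definition adj T : rel V := [rel x y | [exists i in T, G i == [set x; y]]].

Definition spanning_connected T := [forall x, forall y, connect (adj T) x y].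

(* The vertices of a cycle are pairwise distinct, so that its length is at     *)
(* most #|V|.                                                                  *)
Definition acyclic T :=
  [forall k : 'I_#|V|.+1, forall c : k.-tuple V,
     (2 < k)%N ==> ~~ ucycleb (adj T) c].

Definition spanning_tree T := spanning_connected T && acyclic T.

Definition connected_graph := spanning_connected [set: 'I_n].

Definition kirchhoff (R : realType) : {mpoly R[n]} :=
  \sum_(T : {set 'I_n} | spanning_tree T) \prod_(i in T) 'X_i.

End Kirchhoff.

Section Apolarity.
Variables (R : realType) (n : nat).
Implicit Types (P Q F : {mpoly R[n]}) (m : 'X_{1..n}).

(* P(d/dx_1, ..., d/dx_n) F *)
Definition diffop P F : {mpoly R[n]} := \sum_(m <- msupp P) P@_m *: F^`M[m].

Lemma diffopwE k P F : (msize P <= k)%N ->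
  diffop P F = \sum_(m : 'X_{1..n < k}) P@_m *: F^`M[m].
Proof.
move=> leP; rewrite /diffop (big_mksub 'X_{1..n < k}) ?msupp_uniq //=.
  by rewrite big_rmcond //= => i /memN_msupp_eq0 ->; rewrite scale0r.
by move=> m /msize_mdeg_lt /leq_trans; apply.
Qed.

Lemma diffop_is_linear F : linear (diffop^~ F).
Proof.
move=> c P Q; pose k := maxn (msize (c *: P + Q)) (maxn (msize P) (msize Q)).
rewrite !(@diffopwE k) ?leq_max ?leqnn ?orbT //.
rewrite scaler_sumr -big_split /=; apply: eq_bigr => m _.
by rewrite mcoeffD mcoeffZ scalerDl scalerA.
Qed.

Lemma diffop_linearr P : linear (diffop P).
Proof.
move=> c F1 F2; rewrite /diffop scaler_sumr -big_split /=.
apply: eq_bigr => m _; rewrite linearP scalerDr !scalerA.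
by rewrite [c * _]mulrC.
Qed.

HB.instance Definition _ P := GRing.isLinear.Build R {mpoly R[n]} {mpoly R[n]}
  _ (diffop P) (diffop_linearr P).

Lemma diffopX m F : diffop 'X_[m] F = F^`M[m].
Proof. by rewrite /diffop msuppX big_seq1 mcoeffX eqxx scale1r. Qed.

Lemma diffop1 F : diffop 1 F = F.
Proof. by rewrite -mpolyX0 diffopX mderivm0m. Qed.

Lemma diffopB P Q F : diffop (P - Q) F = diffop P F - diffop Q F.
Proof.
have := diffop_is_linear F (-1) Q P; rewrite /= !scaleN1r => dB.
by rewrite addrC dB addrC.
Qed.

Lemma diffopZ c P F : diffop (c *: P) F = c *: diffop P F.
Proof.
have d0 : diffop 0 F = 0 by rewrite /diffop msupp0 big_nil.
by have := diffop_is_linear F c P 0; rewrite /= d0 !addr0.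
Qed.

Lemma diffopD P Q F : diffop (P + Q) F = diffop P F + diffop Q F.
Proof. by have := diffop_is_linear F 1 P Q; rewrite !scale1r. Qed.

Lemma diffopM P Q F : diffop (P * Q) F = diffop P (diffop Q F).
Proof.
have sumE (r : seq 'X_{1..n}) (f : 'X_{1..n} -> {mpoly R[n]}) H :
    diffop (\sum_(m <- r) f m) H = \sum_(m <- r) diffop (f m) H.
  elim: r => [|m r IH]; first by rewrite !big_nil /diffop msupp0 big_nil.
  by rewrite !big_cons diffopD IH.
rewrite {1}[P]mpolyE mulr_suml sumE {2}/diffop; apply: eq_bigr => m _.
rewrite -scalerAl diffopZ; congr (_ *: _).
rewrite {1}[Q]mpolyE mulr_sumr sumE {2}/diffop linear_sum /=.
apply: eq_bigr => m' _; rewrite -scalerAr diffopZ -mpolyXD diffopX linearZ /=.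
by rewrite addmC mderivmDm.
Qed.

Definition Ann F : {pred {mpoly R[n]}} := [pred P | diffop P F == 0].

Lemma Ann_zmod_closed F : zmod_closed (Ann F).
Proof.
split=> [|P Q]; first by rewrite inE /= /diffop msupp0 big_nil.
by rewrite !inE /= diffopB => /eqP -> /eqP ->; rewrite subrr.
Qed.

HB.instance Definition _ F := GRing.isZmodClosed.Build {mpoly R[n]} (Ann F)
  (Ann_zmod_closed F).

Lemma Ann_mull F P Q : Q \in Ann F -> P * Q \in Ann F.
Proof. by rewrite !inE diffopM => /eqP ->; rewrite linear0. Qed.

(* The quotient ring R[x_1, ..., x_n] / Ann F. It is only declared as a ring   *)
(* in which 1 = 0 is allowed (it is trivial when F = 0), hence the library's   *)
(* ring structure on quotients by proper ideals is not available.              *)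
Definition apolar_alg F : Type := {ideal_quot (Ann F)}.

Section ApolarAlgebra.
Variable F : {mpoly R[n]}.
Local Notation A := (apolar_alg F).

HB.instance Definition _ := GRing.Zmodule.on A.
HB.instance Definition _ := EqQuotient.on A.
HB.instance Definition _ :=
  ZmodQuotient.on A.

Lemma apolar_eqP P Q : reflect (\pi_A P = \pi_A Q) (P - Q \in Ann F).
Proof. by rewrite Quotient.idealrBE; apply: eqP. Qed.

Definition apolar_one : A := lift_cst A 1.
Definition apolar_mul : A -> A -> A := lift_op2 A *%R.
Definition apolar_scale (c : R) : A -> A := lift_op1 A ( *:%R c).

Canonical apolar_pi_one_morph := PiConst apolar_one.

Lemma apolar_pi_mul : {morph \pi_A : P Q / P * Q >-> apolar_mul P Q}.
Proof.
move=> P Q; unlock apolar_mul; apply/apolar_eqP.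
set p := repr _; set q := repr _.
have AP : P - p \in Ann F by apply/apolar_eqP; rewrite reprK.
have AQ : Q - q \in Ann F by apply/apolar_eqP; rewrite reprK.
have -> : P * Q - p * q = P * (Q - q) + q * (P - p).
  by rewrite !mulrBr [q * P]mulrC [q * p]mulrC addrA addrNK.
by rewrite rpredD ?Ann_mull.
Qed.
Canonical apolar_pi_mul_morph := PiMorph2 apolar_pi_mul.

Lemma apolar_pi_scale c : {morph \pi_A : P / c *: P >-> apolar_scale c P}.
Proof.
move=> P; unlock apolar_scale; apply/apolar_eqP.
rewrite -scalerBr -mul_mpolyC; apply: Ann_mull.
by apply/apolar_eqP; rewrite reprK.
Qed.
Canonical apolar_pi_scale_morph c := PiMorph1 (apolar_pi_scale c).

Lemma apolar_mulA : associative apolar_mul.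
Proof. by move=> x y z; rewrite -[x]reprK -[y]reprK -[z]reprK !piE mulrA. Qed.

Lemma apolar_mulC : commutative apolar_mul.
Proof. by move=> x y; rewrite -[x]reprK -[y]reprK !piE mulrC. Qed.

Lemma apolar_mul1 : left_id apolar_one apolar_mul.
Proof. by move=> x; rewrite -[x]reprK !piE mul1r. Qed.

Lemma apolar_mulDl : left_distributive apolar_mul +%R.
Proof.
move=> x y z; rewrite -[x]reprK -[y]reprK -[z]reprK.
by rewrite -raddfD -!apolar_pi_mul mulrDl raddfD.
Qed.

HB.instance Definition _ := GRing.Zmodule_isComPzRing.Build A
  apolar_mulA apolar_mulC apolar_mul1 apolar_mulDl.

Lemma apolar_scaleA a b x :
  apolar_scale a (apolar_scale b x) = apolar_scale (a * b) x.
Proof. by rewrite -[x]reprK !piE scalerA. Qed.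

Lemma apolar_scale1 : left_id 1 apolar_scale.
Proof. by move=> x; rewrite -[x]reprK !piE scale1r. Qed.

Lemma apolar_scaleDr : right_distributive apolar_scale +%R.
Proof. by move=> c x y; rewrite -[x]reprK -[y]reprK !piE scalerDr. Qed.

Lemma apolar_scaleDl x : {morph apolar_scale^~ x : a b / a + b}.
Proof. by move=> a b; rewrite -[x]reprK !piE scalerDl. Qed.

HB.instance Definition _ := GRing.Zmodule_isLmodule.Build R A
  apolar_scaleA apolar_scale1 apolar_scaleDr apolar_scaleDl.

Definition graded_part (l : nat) (u : A) : Prop :=
  exists2 P : {mpoly R[n]}, P \is l.-homog & u = \pi_A P.

(* [P] = P(d/dx_1, ..., d/dx_n) F. When F is homogeneous of degree r and P is  *)
(* of degree r, this polynomial is a constant (apolar_degE): the coefficient   *)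
(* below is its value.                                                         *)
Definition apolar_deg (u : A) : R := (diffop (repr u) F)@_0.

Lemma apolar_deg_pi P : apolar_deg (\pi_A P) = (diffop P F)@_0.
Proof.
have : repr (\pi_A P) - P \in Ann F by apply/apolar_eqP; rewrite reprK.
by rewrite inE /= diffopB subr_eq0 /apolar_deg => /eqP ->.
Qed.

Lemma apolar_degE r P : F \is r.-homog -> P \is r.-homog ->
  diffop P F = (apolar_deg (\pi_A P))%:MP.
Proof.
move=> homF homP; apply/mpolyP => m; rewrite apolar_deg_pi mcoeffC.
have [->|m_neq0] := eqVneq m 0%MM; first by rewrite mulr1.
rewrite mulr0 /diffop raddf_sum /= big_seq.
apply: big1 => m' /(dhomog_mf homP) deg_m'.
rewrite mcoeffZ mcoeff_mderivm (dhomog_nemf_coeff homF) ?mul0rn ?mulr0 //=.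
by rewrite mdegD deg_m' -[X in _ != X]addn0 eqn_add2l mdeg_eq0.
Qed.

(* Q_L^1, for F homogeneous of degree r. *)
Definition hodge_riemann1 (r : nat) (L u v : A) : R :=
  apolar_deg (u * L ^+ (r - 2)%N * v).

End ApolarAlgebra.
End Apolarity.

Section BilinearForms.
Variables (R : realType) (U : lmodType R).
Implicit Types (W : U -> Prop) (B : U -> U -> R).

Definition basis_of_subspace W (m : nat) (e : 'I_m -> U) : Prop :=
  (forall i, W (e i)) /\
  (forall u, W u -> exists! c : 'rV[R]_m, u = \sum_i c 0 i *: e i).

Definition nondegenerate_on W B : Prop :=
  forall u, W u -> (forall v, W v -> B u v = 0) -> u = 0.

Definition gram_matrix B (m : nat) (e : 'I_m -> U) : 'M[R]_m :=
  \matrix_(i, j) B (e i) (e j).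

(* s lists the eigenvalues with multiplicity. *)
Definition eigenvalue_signs (m : nat) (M : 'M[R]_m) (pos neg : nat) : Prop :=
  exists s : seq R,
    [/\ char_poly M = \prod_(x <- s) ('X - x%:P),
        count (fun x => 0 < x) s = pos & count (fun x => x < 0) s = neg].

(* The first conjunct says that W has finite dimension. *)
Definition form_signs W B (pos neg : nat) : Prop :=
  (exists m (e : 'I_m -> U), basis_of_subspace W e) /\
  (forall m (e : 'I_m -> U), basis_of_subspace W e ->
     eigenvalue_signs (gram_matrix B e) pos neg).

End BilinearForms.

(* Main.v *)
Require Import Defs.
From HB Require Import structures.
From mathcomp Require Import all_boot all_order all_algebra.
From mathcomp Require Import perm spectral complex ring.
From mathcomp Require Import generic_quotient mpoly reals.

(** The Kirchhoff polynomial is a determinant: by the matrix-tree theorem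
    (weighted_matrix_tree), F(x) = det (B D_x B^T), where B is the incidence
    matrix of the graph with the row of one vertex removed and D_x is the
    diagonal matrix of x. The form det has a Lorentzian Hessian at positive
    definite matrices, and this is inherited by subspaces that contain a
    positive vector; the proof makes this explicit as follows.

    For linear forms the Hodge-Riemann form is, by Euler's identity, (r - 2)!
    times the Hessian of F at the point a (hodge_riemann1_linclass). Put
    A = B D_a B^T, which is positive definite, and g = B^T A^-1 B. As F is
    affine in each variable, its second derivatives are mixed differences,
    and the determinant of a perturbation of A of rank two gives
      d_i d_j F (a) = det A * (g_ii g_jj - g_ij^2).
    The quadratic form of this matrix at u is det A times
      (sum_i u_i g_ii)^2 - tr (g D_u g D_u).
    From g D_a g = g it follows that the subtracted trace is the sum of
    a_e a_f ((g D_u g)_ef)^2 over all e and f, which is positive unless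
    B D_u B^T = 0. For a graph without multiple edges this forces u = 0. Hence
    the Hessian is negative definite on the hyperplane sum_i u_i g_ii = 0,
    while its value at u = a is det A * (r^2 - r) > 0: it is lorentzian in the
    sense defined below.

    A lorentzian matrix is nondegenerate, and by the spectral theorem it has
    exactly one positive eigenvalue and no other nonnegative one. Nondegeneracy
    of the Hessian also shows that the classes of the variables form a basis
    of the degree one part, so that the Gram matrix in any basis is, up to a
    positive factor, congruent to the Hessian. *)

Set Implicit Arguments.
Unset Strict Implicit.
Unset Printing Implicit Defensive.

Import Order.TTheory GRing.Theory Num.Theory.
Local Open Scope ring_scope.
Local Open Scope quotient_scope.

(** * Determinants of products of rectangular matrices *)

Section Determinants.
Variable S : comNzRingType.

Lemma det_mulmx_expand p n (A : 'M[S]_(p, n)) (B : 'M[S]_(n, p)) :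
  \det (A *m B) =
  \sum_(f : {ffun 'I_p -> 'I_n}) (\prod_i A i (f i)) * \det (rowsub f B).
Proof.
pose AB (s : 'S_p) i j := A i j * B j (s i).
transitivity (\sum_(f : {ffun 'I_p -> 'I_n})
    \sum_(s : 'S_p) (-1) ^+ s * \prod_i AB s i (f i)).
  rewrite exchange_big; apply: eq_bigr => /= s _; rewrite -big_distrr /=.
  congr (_ * _); rewrite -(bigA_distr_bigA (AB s)) /=.
  by apply: eq_bigr => x _; rewrite mxE.
apply: eq_bigr => f _; rewrite big_distrr /=; apply: eq_bigr => s _.
rewrite mulrCA big_split //=; congr (_ * (_ * _)).
by apply: eq_bigr => x _; rewrite mxE.
Qed.

Lemma det_rowsub_ninj p n (f : 'I_p -> 'I_n) (B : 'M[S]_(n, p)) :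
  ~ injective f -> \det (rowsub f B) = 0.
Proof.
move=> ninj; have /injectivePn[i1 [i2 ne_i eq_f]] : ~~ injectiveb f.
  by apply/injectiveP.
by apply: (determinant_alternate ne_i) => j; rewrite !mxE eq_f.
Qed.

Definition indicator_row n (T : {set 'I_n}) : 'rV[S]_n := \row_i (i \in T)%:R.

(** Expand the product along maps f from rows to columns, in the manner of
    Cauchy and Binet. Only injective f contribute, each of them with the product
    of x over its image. Specialising x to the indicator of T keeps the maps
    with image in T, and these have image T because both have p elements: so
    the coefficient of the monomial of T is itself such a determinant. *)
Lemma det_mul_diag_mul p n (A : 'M[S]_(p, n)) (x : 'rV[S]_n)
    (B : 'M[S]_(n, p)) :
  \det (A *m diag_mx x *m B) =
  \sum_(T : {set 'I_n} | #|T| == p)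
     (\prod_(i in T) x 0 i) * \det (A *m diag_mx (indicator_row T) *m B).
Proof.
pose c (f : {ffun 'I_p -> 'I_n}) := (\prod_i A i (f i)) * \det (rowsub f B).
(* c f does not depend on the weights, so one expansion serves both sides. *)
have E (y : 'rV[S]_n) : \det (A *m diag_mx y *m B) =
    \sum_(f : {ffun 'I_p -> 'I_n} | injectiveb f) (\prod_i y 0 (f i)) * c f.
  rewrite det_mulmx_expand (bigID (fun f : {ffun _} => injectiveb f)) /=.
  rewrite [X in _ + X]big1 ?addr0.
    apply: eq_bigr => f _; rewrite mulrA -big_split /=; congr (_ * _).
    by apply: eq_bigr => i _; rewrite mul_mx_diag !mxE mulrC.
  by move=> f /injectiveP ninj; rewrite (det_rowsub_ninj B ninj) mulr0.
pose im (f : {ffun 'I_p -> 'I_n}) := [set f i | i in 'I_p].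
have card_im (f : {ffun 'I_p -> 'I_n}) : injectiveb f -> #|im f| == p.
  by move=> /injectiveP inj; rewrite card_imset // card_ord.
rewrite E (partition_big im (fun T => #|T| == p)) //=.
apply: eq_bigr => T /eqP cardT; rewrite E big_distrr /=.
rewrite [RHS](bigID (fun f : {ffun _ -> _} => im f == T)) /=.
rewrite [X in _ + X]big1 ?addr0.
  apply: eq_bigr => f /andP[/injectiveP inj /eqP <-].
  rewrite [X in _ = _ * (X * _)]big1 ?mul1r; last first.
    by move=> i _; rewrite mxE imset_f.
  by rewrite big_imset //=; move=> i j _ _; apply: inj.
move=> f /andP[/[dup] /card_im /eqP cardf _ /eqP neT].
have [i fiT] : exists i, f i \notin T.
  apply/existsP; apply: contra_notT neT; rewrite negb_exists => /forallP fT.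
  apply/eqP; rewrite eqEcard cardT cardf leqnn andbT.
  by apply/subsetP => _ /imsetP[i _ ->]; have := fT i; rewrite negbK.
by rewrite (bigD1 i) //= mxE (negPf fiT) !mul0r mulr0.
Qed.

Lemma mul_indicator_row p n q (A : 'M[S]_(p, n)) (B : 'M[S]_(n, q))
    (T : {set 'I_n}) :
  A *m diag_mx (indicator_row T) *m B =
  colsub (fun k : 'I_#|T| => enum_val k) A *m
  rowsub (fun k : 'I_#|T| => enum_val k) B.
Proof.
apply/matrixP => i j; rewrite !mxE.
rewrite (bigID (fun e => e \in T)) /= [X in _ + X]big1 ?addr0.
  rewrite big_enum_val /=; apply: eq_bigr => k _.
  by rewrite mul_mx_diag !mxE enum_valP mulr1.
by move=> e /negPf neT; rewrite mul_mx_diag !mxE neT mulr0 mul0r.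
Qed.

(** Both sides are the determinant of the block matrix [1, - X; Y, 1]. *)
Lemma det_add1_mulmxC p q (X : 'M[S]_(p, q)) (Y : 'M[S]_(q, p)) :
  \det (1%:M + X *m Y) = \det (1%:M + Y *m X).
Proof.
pose M := block_mx 1%:M (- X) Y 1%:M.
have <- : \det M = \det (1%:M + X *m Y).
  transitivity (\det M * \det (block_mx (1%:M : 'M_p) 0 (- Y) 1%:M)).
    by rewrite det_lblock !det1 !mulr1.
  rewrite -det_mulmx mulmx_block !mul1mx !mulmx1 !mulmx0 !add0r.
  by rewrite mulNmx mulmxN opprK subrr det_ublock det1 mulr1.
transitivity (\det M * \det (block_mx (1%:M : 'M_p) X 0 1%:M)).
  by rewrite det_ublock !det1 !mulr1.
rewrite -det_mulmx mulmx_block !mul1mx !mulmx1 !mulmx0 !addr0.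
by rewrite subrr det_lblock det1 mul1r addrC.
Qed.

End Determinants.

(** * Spanning trees and the weighted matrix-tree theorem *)

Lemma set2_inj (V : finType) (a b x y : V) : a != b ->
  [set a; b] = [set x; y] -> (x = a /\ y = b) \/ (x = b /\ y = a).
Proof.
move=> ne_ab E.
have := set21 x y; rewrite -E => /set2P[] Ex;
  have := set22 x y; rewrite -E => /set2P[] Ey.
- have := set22 a b; rewrite E Ex Ey setUid => /set1P Eb.
  by rewrite Eb eqxx in ne_ab.
- by left.
- by right.
- have := set21 a b; rewrite E Ex Ey setUid => /set1P Eb.
  by rewrite Eb eqxx in ne_ab.
Qed.

Section Graph.
Variables (V : finType) (n : nat) (G : sgraph V n).
Implicit Types (T : {set 'I_n}) (e : 'I_n).

Lemma edge_has_ends e :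
  exists p : V * V, (p.1 != p.2) && (G e == [set p.1; p.2]).
Proof.
have /eqP/cards2P[x [y [ne_xy Ee]]] := edge_card G e.
by exists (x, y); rewrite ne_xy Ee eqxx.
Qed.

(** The chosen order of the two ends of each edge orients the graph. *)
Definition src e := (xchoose (edge_has_ends e)).1.
Definition tgt e := (xchoose (edge_has_ends e)).2.

Lemma src_neq_tgt e : src e != tgt e.
Proof. by have /andP[] := xchooseP (edge_has_ends e). Qed.

Lemma edge_ends e : G e = [set src e; tgt e].
Proof. by have /andP[_ /eqP] := xchooseP (edge_has_ends e). Qed.

Lemma adjP T x y :
  reflect (exists2 e, e \in T & G e = [set x; y]) (adj G T x y).
Proof. exact: 'exists_in_eqP. Qed.

Lemma adj_ends T x y : adj G T x y ->
  exists2 e, e \in T & (x = src e /\ y = tgt e) \/ (x = tgt e /\ y = src e).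
Proof.
case/adjP=> e eT; rewrite edge_ends => /(set2_inj (src_neq_tgt e)).
by exists e.
Qed.

Lemma adj_edge T e : e \in T -> adj G T (src e) (tgt e).
Proof. by move=> eT; apply/adjP; exists e; rewrite // edge_ends. Qed.

Lemma adj_sym T x y : adj G T x y = adj G T y x.
Proof.
by apply/adjP/adjP=> -[e eT Ee]; exists e; rewrite // setUC.
Qed.

Lemma connect_adjC T x y : connect (adj G T) x y = connect (adj G T) y x.
Proof. exact/sym_connect_sym/adj_sym. Qed.

Lemma connect_edge T e : e \in T -> connect (adj G T) (src e) (tgt e).
Proof. by move=> eT; apply/connect1/adj_edge. Qed.

Lemma spanning_connectedP T :
  reflect (forall x y, connect (adj G T) x y) (spanning_connected G T).
Proof. exact: 'forall_forallP. Qed.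

(** A simple path that joins the ends of e and avoids e is closed by e to a
    cycle; its length exceeds 2 because no other edge has the same ends. *)
Lemma acyclic_edge_cut T e : acyclic G T -> e \in T ->
  ~~ connect (adj G (T :\ e)) (src e) (tgt e).
Proof.
move=> acT eT; apply/negP => /connectP[p0].
case/shortenP=> p path_p uniq_p _ /esym last_p.
have sub_adj x y : adj G (T :\ e) x y -> adj G T x y.
  by case/adjP=> f /setD1P[_ fT] Ef; apply/adjP; exists f.
have lt_size : (size (src e :: p) < #|V|.+1)%N.
  by rewrite ltnS -(card_uniqP uniq_p) max_card.
move/forallP: acT => /(_ (Ordinal lt_size))/forallP/(_ (in_tuple (src e :: p))).
move/implyP; rewrite /= => acT.
have ne := src_neq_tgt e.
case: p => [|y [|z p]] in path_p uniq_p last_p acT lt_size *.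
- by move: last_p ne => /= ->; rewrite eqxx.
- move: path_p; rewrite /= andbT -[y]/(last (src e) [:: y]) last_p.
  case/adjP=> f /setD1P[ne_fe _]; rewrite -edge_ends.
  by move/edge_inj/eqP; rewrite (negPf ne_fe).
have /negP := acT isT; apply; rewrite /ucycleb uniq_p andbT /cycle rcons_path.
rewrite last_p adj_sym adj_edge // andbT.
by apply: sub_path path_p; apply: sub_adj.
Qed.

(** The first edge of the cycle can be replaced by the rest of the cycle, which
    does not use that edge again because the vertices are distinct. *)
Lemma cycle_edge_redundant T c : spanning_connected G T -> (2 < size c)%N ->
  ucycleb (adj G T) c -> exists2 e, e \in T & spanning_connected G (T :\ e).
Proof.
case: c => [|x [|y [|z c]]] // /spanning_connectedP conT _ /andP[cyc uniq_c].
move: cyc; rewrite /cycle rcons_cons /= -/(path _ z _) rcons_path.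
move=> /and3P[/adjP[e eT Ee] adj_yz /andP[path_c adj_cx]].
exists e => //.
have keep u v : adj G T u v -> [set u; v] != G e -> adj G (T :\ e) u v.
  case/adjP=> f fT Ef ne; apply/adjP; exists f => //.
  by rewrite in_setD1 fT andbT; apply: contraNneq ne => <-; rewrite Ef.
move: uniq_c; rewrite cons_uniq => /andP[x_notin uniq_c].
have con_y w s : path (adj G T) w s -> x \notin w :: s ->
    connect (adj G (T :\ e)) w (last w s).
  elim: s w => [|v s IHs] w //= /andP[adj_wv path_s].
  rewrite inE negb_or => /andP[ne_xw x_s].
  apply: connect_trans (IHs v path_s x_s); apply/connect1/keep => //.
  apply: contraNneq x_s => E; have : x \in G e by rewrite Ee set21.
  rewrite -E => /set2P[] Ex; last by rewrite Ex mem_head.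
  by rewrite Ex eqxx in ne_xw.
have con_yx : connect (adj G (T :\ e)) y x.
  apply: connect_trans (con_y y (z :: c) _ _) _ => //=; first by rewrite adj_yz.
  apply/connect1/keep => //.
  have l_in : last z c \in z :: c by apply: mem_last.
  apply: contraTneq uniq_c => E; have : y \in G e by rewrite Ee set22.
  rewrite -E => /set2P[] Ey; first by rewrite /= Ey l_in.
  by rewrite -Ey mem_head in x_notin.
apply/spanning_connectedP => u v.
apply: connect_sub (conT u v) => {u v} u v adj_uv.
have [E|] := eqVneq [set u; v] (G e); last by move/(keep _ _ adj_uv)/connect1.
have ne_xy : x != y by move: x_notin; rewrite inE negb_or => /andP[].
move: E; rewrite Ee => /esym/(set2_inj ne_xy)[] [-> ->] //.
by rewrite connect_adjC.
Qed.

Section Incidence.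
Variables (r : nat) (hV : #|V| = r.+1).

Definition vertex (i : 'I_r.+1) : V := enum_val (cast_ord (esym hV) i).

Lemma vertex_bij : bijective vertex.
Proof.
exists (fun v => cast_ord hV (enum_rank v)) => [i|v]; rewrite /vertex.
  by rewrite enum_valK cast_ordKV.
by rewrite cast_ordK enum_rankK.
Qed.

Definition root_vertex := vertex ord0.

Section Scalars.
Variable S : comNzRingType.

(** The row of the root is left out because the rows of the full incidence
    matrix add up to 0. *)
Definition incidence : 'M[S]_(r, n) := \matrix_(i, e)
  ((vertex (lift ord0 i) == src e)%:R - (vertex (lift ord0 i) == tgt e)%:R).

(** A function on the vertices acts on the incidence matrix through its
    differences along edges, so it may be normalised to vanish at the root;
    this makes up for the missing row. *)
Definition potential (phi : V -> S) : 'rV[S]_r :=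
  \row_i (phi (vertex (lift ord0 i)) - phi root_vertex).

Lemma potential_incidence phi e :
  (potential phi *m incidence) 0 e = phi (src e) - phi (tgt e).
Proof.
have pick v : \sum_(i < r) (phi (vertex (lift ord0 i)) - phi root_vertex) *
    (vertex (lift ord0 i) == v)%:R = phi v - phi root_vertex.
  transitivity (\sum_w (phi w - phi root_vertex) * (w == v)%:R).
    rewrite (reindex vertex) /=; last exact/onW_bij/vertex_bij.
    by rewrite big_ord_recl subrr mul0r add0r.
  rewrite (bigD1 v) //= eqxx mulr1 big1 ?addr0 // => w /negPf ->.
  by rewrite mulr0.
rewrite mxE; under eq_bigr => i _ do rewrite !mxE mulrBr.
by rewrite big_split /= sumrN !pick opprB addrA subrK.
Qed.

(** The unit flow along a path from x to y. Its divergence is stated by pairing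
    it with all potentials phi. *)
Lemma connect_flow T x y : connect (adj G T) x y ->
  exists c : 'I_n -> S, forall phi : V -> S,
    \sum_(e in T) (phi (src e) - phi (tgt e)) * c e = phi x - phi y.
Proof.
case/connectP=> p; elim: p x => [|z p IHp] x /=.
  move=> _ ->; exists (fun=> 0) => phi; rewrite subrr big1 // => e _.
  by rewrite mulr0.
case/andP=> /adj_ends[e eT Ee] path_p /(IHp _ path_p)[c Ec].
have step (s : S) :
    (forall phi : V -> S, (phi (src e) - phi (tgt e)) * s = phi x - phi z) ->
    exists c : 'I_n -> S, forall phi : V -> S,
    \sum_(e in T) (phi (src e) - phi (tgt e)) * c e = phi x - phi y.
  move=> Es; exists (fun f => (f == e)%:R * s + c f) => phi.
  under eq_bigr => f _ do rewrite mulrDr.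
  rewrite big_split /= Ec (bigD1 e) //= eqxx mul1r Es.
  rewrite big1 ?addr0 ?addrA ?subrK //.
  by move=> f /andP[_ /negPf ->]; rewrite mul0r mulr0.
(* The edge is used with or against its orientation. *)
case: Ee => -[Ex Ez]; [apply: (step 1) | apply: (step (-1))] => phi;
  rewrite Ex Ez.
  by rewrite mulr1.
by rewrite mulrN1 opprB.
Qed.

(** The unit flows in T from each vertex to the root are the columns of a right
    inverse. That this holds over the integers gives unimodularity. *)
Lemma connected_incidence_rinv T : spanning_connected G T ->
  exists C : 'M[S]_(n, r), incidence *m diag_mx (indicator_row S T) *m C = 1%:M.
Proof.
move=> /spanning_connectedP conT.
have [c Ec] := fin_all_exists (fun j : 'I_r =>
  connect_flow (conT (vertex (lift ord0 j)) root_vertex)).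
exists (\matrix_(e, j) c j e); apply/matrixP => i j.
have := Ec j (fun w => (w == vertex (lift ord0 i))%:R).
rewrite !(inj_eq (bij_inj vertex_bij)) (inj_eq lift_inj) subr0 eq_sym.
rewrite [X in _ -> _ = X]mxE => <-; rewrite mxE [RHS]big_mkcond /=.
apply: eq_bigr => e _; rewrite mul_mx_diag !mxE ![_ == vertex _]eq_sym.
by case: (e \in T); rewrite ?mulr1 // mulr0 mul0r.
Qed.

End Scalars.

Lemma map_incidence (S : comNzRingType) :
  map_mx (intr : int -> S) (incidence int) = incidence S.
Proof. by apply/matrixP=> i e; rewrite !mxE rmorphB !rmorph_nat. Qed.

Lemma connected_card T : spanning_connected G T -> (r <= #|T|)%N.
Proof.
case/(connected_incidence_rinv int) => C.
by rewrite mul_indicator_row => /mulmx1_min.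
Qed.

(** Removing an edge e of a forest separates its ends, so the indicator of the
    component of src e is a potential whose difference is 1 along e and 0 along
    the other edges of T: the columns of T have a left inverse. *)
Lemma acyclic_card T : acyclic G T -> (#|T| <= r)%N.
Proof.
move=> acT.
pose phi e w : int := (connect (adj G (T :\ e)) (src e) w)%:R.
pose D := \matrix_(k < #|T|, i < r) potential (phi (enum_val k)) 0 i.
suff : D *m colsub (fun k : 'I_#|T| => enum_val k) (incidence int) = 1%:M.
  exact: mulmx1_min.
apply/matrixP => k l; rewrite mulmx_colsub mxE.
have -> : (D *m incidence int) k (enum_val l) =
    (potential (phi (enum_val k)) *m incidence int) 0 (enum_val l).
  by rewrite !mxE; apply: eq_bigr => i _; rewrite [in LHS]mxE.
rewrite potential_incidence !mxE /phi.
have [<-|ne_kl] := eqVneq k l.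
  by rewrite connect0 (negPf (acyclic_edge_cut acT (enum_valP k))) subr0.
have lT : enum_val l \in T :\ enum_val k.
  by rewrite in_setD1 enum_valP andbT (inj_eq enum_val_inj) eq_sym.
rewrite (same_connect_r _ (connect_edge lT)) ?subrr //.
exact: connect_adjC.
Qed.

(** A connected set of r edges has no cycle, since an edge of a cycle could be
    removed, leaving a connected set with fewer than r edges. *)
Lemma spanning_treeE T :
  spanning_tree G T = spanning_connected G T && (#|T| == r).
Proof.
apply/andP/andP => -[conT].
  by move=> acT; rewrite conT eqn_leq connected_card ?acyclic_card.
move=> /eqP cardT; split=> //; apply/forallP => k; apply/forallP => c.
apply/implyP => k_gt2; apply/negP => cyc.
have [|e eT] := cycle_edge_redundant conT _ cyc; first by rewrite size_tuple.
by move/connected_card; rewrite -cardT (cardsD1 e T) eT ltnn.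
Qed.

Lemma det_mul_tr_rinv p q (X : 'M[int]_(p, q)) (Y : 'M[int]_(q, p)) :
  q = p -> X *m Y = 1%:M -> \det (X *m X^T) = 1.
Proof.
move=> Eq; case: p / Eq in X Y * => XY1.
have /mulmx1_unit[] := XY1; rewrite unitmxE det_mulmx det_tr => + _.
by case/orP=> /eqP ->.
Qed.

(** If T is connected, the square incidence matrix of T is invertible over the
    integers, hence of determinant 1 or -1. Otherwise the indicator of the
    component of the root, normalised to vanish there, is a nonzero vector in
    the kernel. *)
Lemma det_tree_laplacian T : #|T| = r ->
  \det (incidence int *m diag_mx (indicator_row int T) *m (incidence int)^T) =
  (spanning_connected G T)%:R.
Proof.
move=> cardT; have [conT|disT] := boolP (spanning_connected G T).
  have [C] := connected_incidence_rinv int conT; rewrite !mul_indicator_row.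
  move=> /(det_mul_tr_rinv cardT) <-; congr (\det (_ *m _)).
  by apply/matrixP=> i j; rewrite !mxE.
have [v v_cut] : exists v, ~~ connect (adj G T) v root_vertex.
  apply/existsP; apply: contraNT disT; rewrite negb_exists => /forallP con.
  apply/spanning_connectedP => x y; apply: (@connect_trans _ _ root_vertex).
    by have := con x; rewrite negbK.
  by rewrite connect_adjC; have := con y; rewrite negbK.
pose phi w : int := (connect (adj G T) w root_vertex)%:R.
apply/eqP/det0P; exists (potential phi).
  apply/eqP => /rowP E.
  have [g vertexK gK] := vertex_bij.
  have := gK v; case: (unliftP ord0 (g v)) => [i ->|->] Ev; last first.
    by rewrite -Ev connect0 in v_cut.
  have := E i; rewrite !mxE Ev /phi connect0 (negPf v_cut).
  by move/eqP; rewrite sub0r oppr_eq0 oner_eq0.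
rewrite mulmxA.
suff -> : potential phi *m (incidence int *m diag_mx (indicator_row int T)) = 0.
  by rewrite mul0mx.
apply/rowP => e; rewrite mulmxA mul_mx_diag mxE potential_incidence !mxE.
have [eT|] := boolP (e \in T); last by rewrite mulr0.
by rewrite /phi (same_connect (connect_adjC _) (connect_edge eT)) subrr mul0r.
Qed.

(** Only sets of r edges contribute, and the coefficient of such a set is an
    integer determinant, which is then mapped to S. *)
Theorem weighted_matrix_tree (S : comNzRingType) (x : 'rV[S]_n) :
  \det (incidence S *m diag_mx x *m (incidence S)^T) =
  \sum_(T : {set 'I_n} | spanning_tree G T) \prod_(i in T) x 0 i.
Proof.
rewrite det_mul_diag_mul.
under [RHS]eq_bigl => T do rewrite spanning_treeE andbC.
rewrite big_mkcondr /=; apply: eq_bigr => T /eqP cardT.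
have -> : \det (incidence S *m diag_mx (indicator_row S T) *m (incidence S)^T) =
    (spanning_connected G T)%:R.
  rewrite -(rmorph_nat (intr : int -> S)) -(det_tree_laplacian cardT).
  rewrite -det_map_mx !map_mxM map_diag_mx -map_trmx map_incidence.
  congr (\det (_ *m diag_mx _ *m _)).
  by apply/rowP => i; rewrite !mxE rmorph_nat.
by case: ifP; rewrite ?mulr1 ?mulr0.
Qed.

End Incidence.
End Graph.

(** * Determinants of weighted Gram matrices *)

Section WeightedGram.
Variables (F : fieldType) (r n : nat) (B : 'M[F]_(r, n)) (a : 'rV[F]_n).

Definition weighted_gram (x : 'rV[F]_n) : 'M[F]_r := B *m diag_mx x *m B^T.

Local Notation A := (weighted_gram a).

(** The Gram matrix of the columns of B for the inverse of the form A. If B is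
    the reduced incidence matrix of a graph and a is read as conductances, its
    diagonal holds the effective resistances between the ends of the edges. *)
Definition effective_gram : 'M[F]_n := B^T *m invmx A *m B.
Local Notation g := effective_gram.

Lemma weighted_gram_tr x : (weighted_gram x)^T = weighted_gram x.
Proof. by rewrite /weighted_gram !trmx_mul trmxK tr_diag_mx mulmxA. Qed.

Lemma weighted_gramD x y :
  weighted_gram (x + y) = weighted_gram x + weighted_gram y.
Proof. by rewrite /weighted_gram raddfD /= mulmxDr mulmxDl. Qed.

Lemma weighted_gram_delta k (f : 'I_k -> 'I_n) :
  weighted_gram (\sum_l delta_mx 0 (f l)) = colsub f B *m (colsub f B)^T.
Proof.
rewrite /weighted_gram raddf_sum mulmx_sumr mulmx_suml.
apply/matrixP=> i j; rewrite summxE mxE; apply: eq_bigr => l _.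
rewrite mxE (bigD1 (f l)) //= mul_mx_diag !mxE !eqxx mulr1 big1 ?addr0 //.
by move=> e /negPf ne; rewrite !mxE ne andbF mulr0 mul0r.
Qed.

(** Raising the weights of the columns f by 1 adds a matrix X X^T of rank at
    most k, so that the determinant reduces to one of size k. *)
Lemma det_weighted_gram_bump k (f : 'I_k -> 'I_n) : A \in unitmx ->
  \det (weighted_gram (a + \sum_l delta_mx 0 (f l))) =
  \det A * \det (1%:M + mxsub f f g).
Proof.
move=> uA; rewrite weighted_gramD weighted_gram_delta.
set X := colsub f B.
have -> : A + X *m X^T = A *m (1%:M + (invmx A *m X) *m X^T).
  by rewrite mulmxDr mulmx1 !mulmxA mulmxV // mul1mx.
rewrite det_mulmx det_add1_mulmxC; congr (_ * \det (_ + _)).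
by rewrite mxsub_mul -mul_rowsub_mx -trmx_mxsub mulmxA.
Qed.

Lemma det_mx2 (M : 'M[F]_2) : \det M = M 0 0 * M 1 1 - M 0 1 * M 1 0.
Proof.
rewrite (expand_det_row _ 0) !big_ord_recl big_ord0 addr0 /cofactor !det_mx11.
rewrite !mxE /= expr0 mul1r expr1 mulN1r mulrN.
by congr (M _ _ * M _ _ - M _ _ * M _ _); apply: val_inj.
Qed.

Lemma mixed_difference_det_weighted_gram i j : A \in unitmx ->
  let d k : 'rV[F]_n := delta_mx 0 k in
  \det (weighted_gram (a + d i + d j)) - \det (weighted_gram (a + d i))
    - \det (weighted_gram (a + d j)) + \det A =
  \det A * (g i i * g j j - g i j * g j i).
Proof.
move=> uA d.
have bump1 k : \det (weighted_gram (a + d k)) = \det A * (1 + g k k).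
  have := det_weighted_gram_bump (fun=> k) uA (k := 1%N).
  by rewrite big_ord1 => ->; rewrite det_mx11; move: g => h; rewrite !mxE.
have := det_weighted_gram_bump (fun l : 'I_2 => if l == 0 then i else j) uA.
rewrite !big_ord_recl big_ord0 /= addr0 addrA => ->.
rewrite (bump1 i) (bump1 j).
move: g (\det A) => h D; rewrite det_mx2 !mxE /=; ring.
Qed.

Lemma effective_gram_tr : g^T = g.
Proof.
by rewrite /g !trmx_mul trmxK trmx_inv weighted_gram_tr mulmxA.
Qed.

Lemma effective_gram_mul x : g *m diag_mx x *m g =
  B^T *m invmx A *m weighted_gram x *m invmx A *m B.
Proof. by rewrite /g /weighted_gram !mulmxA. Qed.

Lemma effective_gram_idem : A \in unitmx -> g *m diag_mx a *m g = g.
Proof. by move=> uA; rewrite effective_gram_mul mulmxKV. Qed.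

(** The trace of D_a B^T A^-1 B is that of A^-1 A, by cyclicity. *)
Lemma effective_gram_trace : A \in unitmx -> \sum_i a 0 i * g i i = r%:R.
Proof.
move=> uA; transitivity (\tr (diag_mx a *m g)).
  by apply: eq_bigr => i _; rewrite mul_diag_mx [in RHS]mxE.
rewrite /effective_gram -mulmxA mulmxA mxtrace_mulC -mulmxA.
rewrite (_ : B *m _ = A); last by rewrite /weighted_gram mulmxA.
by rewrite mulVmx // mxtrace1.
Qed.

(** In g D_x g = B^T A^-1 (B D_x B^T) A^-1 B the factors B^T A^-1 and A^-1 B can
    be cancelled, as B has a right inverse. *)
Lemma effective_gram_faithful C x : A \in unitmx -> B *m C = 1%:M ->
  (forall y, weighted_gram y = 0 -> y = 0) ->
  g *m diag_mx x *m g = 0 -> x = 0.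
Proof.
move=> uA BC inj; rewrite effective_gram_mul => E; apply: inj.
move: (weighted_gram x) (weighted_gram a) uA E => W A uA E.
have : C^T *m (B^T *m invmx A *m W *m invmx A *m B) *m C = 0.
  by rewrite E mulmx0 mul0mx.
rewrite !mulmxA -trmx_mul BC trmx1 mul1mx -mulmxA BC mulmx1 => {}E.
by rewrite -[W](mulKVmx uA) -[invmx A *m W](mulmxKV uA) E mul0mx mulmx0.
Qed.

End WeightedGram.

(** * Lorentzian matrices and their eigenvalues *)

Definition quad_form (R : pzRingType) m (M : 'M[R]_m) (u : 'rV[R]_m) : R :=
  (u *m M *m u^T) 0 0.

Lemma quad_formE (R : comPzRingType) m (M : 'M[R]_m) (u : 'rV_m) :
  quad_form M u = \sum_j \sum_i M i j * (u 0 i * u 0 j).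
Proof.
rewrite /quad_form mxE; apply: eq_bigr => j _; rewrite !mxE mulr_suml.
by apply: eq_bigr => i _; rewrite mulrAC mulrC.
Qed.

Lemma char_poly_conj (F : fieldType) m (P M : 'M[F]_m) : P \in unitmx ->
  char_poly (invmx P *m M *m P) = char_poly M.
Proof.
move=> uP; rewrite /char_poly.
pose Q := map_mx polyC P; pose Q' := map_mx polyC (invmx P).
have QQ : Q' *m Q = 1%:M by rewrite -map_mxM mulVmx // map_mx1.
have -> : char_poly_mx (invmx P *m M *m P) = Q' *m char_poly_mx M *m Q.
  rewrite /char_poly_mx !map_mxM mulmxBr mulmxBl scalar_mxC.
  by rewrite -[in X in _ = X - _]mulmxA QQ mulmx1.
by rewrite !det_mulmx mulrAC -det_mulmx QQ det1 mul1r.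
Qed.

(** Signature (1, m - 1), expressed by a hyperplane on which the form is
    negative definite together with a positive vector. In this form the
    condition is visibly invariant under congruence. *)
Definition lorentzian (R : realFieldType) m (M : 'M[R]_m) : Prop :=
  [/\ M^T = M,
      exists t : 'cV[R]_m, forall u, u *m t = 0 -> u != 0 -> quad_form M u < 0
    & exists u, 0 < quad_form M u].

(** Write q for the form and t for the equation of the hyperplane, and let
    q(p) > 0. For u in the kernel, w = (p t) u - (u t) p lies in the hyperplane and has
    q(w) = (u t)^2 q(p) >= 0, so w = 0 and u t = 0; then u itself lies in the
    hyperplane, and q(u) = 0 forces u = 0. *)
Lemma lorentzian_nondegenerate (R : realFieldType) m (M : 'M[R]_m) (u : 'rV_m) :
  lorentzian M -> u *m M = 0 -> u = 0.
Proof.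
case=> M_sym [t neg_t] [p p_gt0] uM; apply/eqP/negPn/negP => u_neq0.
have Mu : M *m u^T = 0 by rewrite -[M]M_sym -trmx_mul uM trmx0.
have qu : quad_form M u = 0 by rewrite /quad_form uM mul0mx mxE.
pose w := (p *m t) 0 0 *: u - (u *m t) 0 0 *: p.
have wt : w *m t = 0.
  apply/matrixP=> i j; rewrite !ord1 mulmxBl -!scalemxAl.
  move: (p *m t) (u *m t) => x y.
  by rewrite !mxE mulrC subrr.
have qw : quad_form M w = (u *m t) 0 0 ^+ 2 * quad_form M p.
  have wM : w *m M = - (u *m t) 0 0 *: (p *m M).
    by rewrite mulmxBl -!scalemxAl uM scaler0 sub0r scaleNr.
  have Mw : M *m w^T = - (u *m t) 0 0 *: (M *m p^T).
    by rewrite -[M]M_sym -!trmx_mul wM linearZ.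
  rewrite /quad_form wM -scalemxAl -mulmxA Mw -scalemxAr scalerA mulrNN.
  by rewrite mxE mulmxA expr2.
have [w0|/(neg_t _ wt)] := eqVneq w 0; last first.
  by rewrite qw ltNge mulr_ge0 ?sqr_ge0 // ltW.
have : quad_form M w = 0 by rewrite w0 /quad_form !mul0mx mxE.
move/eqP; rewrite qw mulf_eq0 (gt_eqF p_gt0) orbF sqrf_eq0 => /eqP ut.
have : quad_form M u < 0.
  by apply: neg_t => //; apply/matrixP=> i j; rewrite !ord1 ut mxE.
by rewrite qu ltxx.
Qed.

Lemma lorentzian_congr (R : realFieldType) m (P M : 'M[R]_m) :
  P \in unitmx -> lorentzian M -> lorentzian (P *m M *m P^T).
Proof.
move=> uP [M_sym [t neg_t] [p p_gt0]].
have E u : quad_form (P *m M *m P^T) u = quad_form M (u *m P).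
  by rewrite /quad_form trmx_mul !mulmxA.
split; first by rewrite !trmx_mul trmxK M_sym mulmxA.
  exists (P *m t) => u; rewrite mulmxA E => ut u_neq0; apply: neg_t => //.
  by apply: contra_neq u_neq0 => uP0; rewrite -[u](mulmxK uP) uP0 mul0mx.
by exists (p *m invmx P); rewrite E mulmxKV.
Qed.

Lemma lorentzian_scale (R : realFieldType) m (c : R) (M : 'M[R]_m) :
  0 < c -> lorentzian M -> lorentzian (c *: M).
Proof.
move=> c_gt0 [M_sym [t neg_t] [p p_gt0]].
have E u : quad_form (c *: M) u = c * quad_form M u.
  by rewrite /quad_form -scalemxAr -scalemxAl mxE.
split; first by rewrite linearZ /= M_sym.
  by exists t => u ut u_neq0; rewrite E pmulr_rlt0 ?neg_t.
by exists p; rewrite E mulr_gt0.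
Qed.

Section RealSpectral.
Variables (R : rcfType) (m : nat) (M : 'M[R]_m).
Local Notation re := (@complex.Re R).
Local Notation im := (@complex.Im R).

(** Diagonalise M, as a Hermitian matrix, in a unitary basis given by the rows
    of P. The value at v of the Hermitian form of a real symmetric matrix is the
    sum of the values of the quadratic form at the real and imaginary parts of
    v. *)
Lemma real_symmetric_spectral : M^T = M ->
  exists (d : 'rV[R]_m) (P : 'M[R[i]]_m),
  [/\ P \in unitmx, char_poly M = \prod_k ('X - (d 0 k)%:P) &
      forall c : 'rV[R[i]]_m, let v := c *m P in
      \sum_k d 0 k * (re (c 0 k) ^+ 2 + im (c 0 k) ^+ 2) =
      quad_form M (map_mx re v) + quad_form M (map_mx im v)].
Proof.
move=> M_sym; pose MC := map_mx (real_complex R) M.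
have herm : MC \is hermitianmx _ false Num.conj.
  apply/is_hermitianmxP; rewrite expr0 scale1r /MC -[in LHS]M_sym.
  by apply/matrixP=> i j; rewrite !mxE; apply/esym/conjc_real.
have [d [P [uP unitaryP EM]]] : exists (d : 'rV[R]_m) P,
    [/\ P \in unitmx, P \is unitarymx &
        MC = invmx P *m diag_mx (map_mx (real_complex R) d) *m P].
  exists (map_mx re (spectral_diag MC)), (spectralmx MC).
  split; rewrite ?spectral_unit ?spectral_unitarymx //.
  rewrite -map_mx_comp map_mx_id_in; last first.
    move=> k l /=; rewrite RRe_real //.
    by have /mxOverP := hermitian_spectral_diag_real herm; apply.
  by have /hermitian_normalmx/orthomx_spectralP := herm.
exists d, P; split=> //.
  apply: (map_poly_inj (real_complex R)).
  rewrite map_char_poly -/MC EM char_poly_conj //.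
  rewrite char_poly_trig ?diag_mx_is_trig // rmorph_prod /=.
  apply: eq_bigr => k _.
  by rewrite !mxE eqxx mulr1n rmorphB /= map_polyX map_polyC.
move=> c v.
have ReD (x y : R[i]) : re (x + y) = re x + re y by case: x y => [? ?] [].
have Re_sum I r (F : I -> R[i]) :
    re (\sum_(i <- r) F i) = \sum_(i <- r) re (F i).
  by apply: (big_morph re).
have : re ((v *m MC *m map_mx Num.conj v^T) 0 0) =
    re ((c *m diag_mx (map_mx (real_complex R) d) *m map_mx Num.conj c^T) 0 0).
  congr (re (_ 0 0)).
  have PM : P *m MC = diag_mx (map_mx (real_complex R) d) *m P.
    by rewrite EM -mulmxA mulKVmx.
  have /unitarymxP PP := unitaryP.
  by rewrite /v trmx_mul map_mxM -(mulmxA c) PM !mulmxA -(mulmxA _ P) PP mulmx1.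
rewrite ![in LHS]mxE ![in RHS]mxE !Re_sum => E.
transitivity (\sum_k re ((c *m diag_mx (map_mx (real_complex R) d)) 0 k *
    map_mx Num.conj c^T k 0)).
  apply: eq_bigr => k _; rewrite mul_mx_diag !mxE.
  by case: (c 0 k) => x y /=; ring.
rewrite -E !quad_formE -big_split /=; apply: eq_bigr => j _.
rewrite -big_split [in LHS]mxE mulr_suml Re_sum; apply: eq_bigr => i _.
clearbody v; rewrite !mxE; case: (v 0 i) (v 0 j) => [x y] [x' y'] /=; ring.
Qed.

(** A positive vector requires a positive eigenvalue d_k0. If another eigenvalue
    were nonnegative, some nonzero combination of the two eigenvectors would lie
    in the complexified hyperplane, where the form is negative definite, while
    the form is nonnegative on their span. *)
Lemma lorentzian_eigenvalues : lorentzian M -> exists (d : 'rV[R]_m) k0,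
  [/\ char_poly M = \prod_k ('X - (d 0 k)%:P), 0 < d 0 k0 &
      forall k, k != k0 -> d 0 k < 0].
Proof.
case=> M_sym [t neg_t] [p p_gt0].
have [d [P [uP charM diagM]]] := real_symmetric_spectral M_sym.
pose toC := real_complex R.
have norm_ge0 (z : R[i]) : 0 <= re z ^+ 2 + im z ^+ 2.
  by rewrite addr_ge0 ?sqr_ge0.
have [k0 d_k0] : exists k, 0 < d 0 k.
  apply/existsP; apply: contraTT p_gt0; rewrite negb_exists => /forallP d_le0.
  have := diagM (map_mx toC p *m invmx P); rewrite /= mulmxKV //.
  rewrite -!map_mx_comp [X in _ + quad_form M X](_ : _ = 0); last first.
    by apply/rowP=> k; rewrite !mxE.
  rewrite map_mx_id // [X in _ + X](_ : _ = 0) ?addr0; last first.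
    by rewrite /quad_form !mul0mx mxE.
  rewrite -leNgt => <-; apply: sumr_le0 => k _; apply: mulr_le0_ge0 => //.
  by rewrite leNgt.
exists d, k0; split=> // k ne_k; rewrite ltNge; apply/negP => d_k.
pose z l := (row l P *m map_mx toC t) 0 0.
have [c [c_neq0 c_supp ct]] : exists c : 'rV[R[i]]_m,
    [/\ c != 0, forall l, l != k -> l != k0 -> c 0 l = 0 &
        c *m P *m map_mx toC t = 0].
  (* z l is the value of the equation of the hyperplane at row l of P. If c0 is
     zero, then z k0 = 0 and row k0 itself lies in the hyperplane. *)
  pose c0 : 'rV[R[i]]_m := z k *: delta_mx 0 k0 - z k0 *: delta_mx 0 k.
  have Ez l : delta_mx 0 l *m P *m map_mx toC t = (z l)%:M.
    by rewrite -rowE [LHS]mx11_scalar.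
  have [c0_eq0|c0_neq0] := eqVneq c0 0; last first.
    exists c0; split=> // [l /negPf ne1 /negPf ne2|].
      by rewrite !mxE ne1 ne2 !mulr0 subrr.
    rewrite !mulmxBl -!scalemxAl !Ez.
    by rewrite !scale_scalar_mx mulrC subrr.
  exists (delta_mx 0 k0); split=> [|l _ /negPf ne|].
  - apply/eqP => /rowP/(_ k0)/eqP; rewrite !mxE !eqxx.
    by rewrite (negPf (oner_neq0 _)).
  - by rewrite mxE ne andbF.
  - rewrite Ez; have /rowP/(_ k) := c0_eq0; rewrite !mxE !eqxx (negPf ne_k) /=.
    rewrite mulr0 mulr1 sub0r => /eqP; rewrite oppr_eq0 => /eqP ->.
    exact: raddf0.
have := diagM c; cbv zeta; set v := c *m P => E.
have sum_ge0 : 0 <= \sum_l d 0 l * (re (c 0 l) ^+ 2 + im (c 0 l) ^+ 2).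
  apply: sumr_ge0 => l _.
  have [->|ne1] := eqVneq l k; first exact: mulr_ge0.
  have [->|ne2] := eqVneq l k0; first by rewrite mulr_ge0 // ltW.
  by rewrite c_supp //= expr0n addr0 mulr0.
have v_neq0 : v != 0.
  by apply: contra_neq c_neq0 => v0; rewrite -[c](mulmxK uP) -/v v0 mul0mx.
have reD (x y : R[i]) : re (x + y) = re x + re y by case: x y => [? ?] [].
have re_sum I r (F : I -> R[i]) :
    re (\sum_(i <- r) F i) = \sum_(i <- r) re (F i).
  by apply: (big_morph re).
have imD (x y : R[i]) : im (x + y) = im x + im y by case: x y => [? ?] [].
have im_sum I r (F : I -> R[i]) :
    im (\sum_(i <- r) F i) = \sum_(i <- r) im (F i).
  by apply: (big_morph im).
have re_t : map_mx re v *m t = 0.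
  rewrite -(map_mx0 re) -ct; apply/matrixP=> i j.
  rewrite mxE [RHS]mxE [in RHS]mxE.
  apply/esym; apply: etrans (re_sum _ _ _) _; apply: eq_bigr => l _.
  by rewrite !mxE; case: (\sum_(j < m) _) => x y /=; rewrite mulr0 subr0.
have im_t : map_mx im v *m t = 0.
  rewrite -(map_mx0 im) -ct; apply/matrixP=> i j.
  rewrite mxE [RHS]mxE [in RHS]mxE.
  apply/esym; apply: etrans (im_sum _ _ _) _; apply: eq_bigr => l _.
  by rewrite !mxE; case: (\sum_(j < m) _) => x y /=; rewrite mulr0 add0r.
have q_le0 x : x *m t = 0 -> quad_form M x <= 0.
  have [->|x_neq0] := eqVneq x 0; first by rewrite /quad_form !mul0mx mxE.
  by move=> xt; apply/ltW/neg_t.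
suff : quad_form M (map_mx re v) + quad_form M (map_mx im v) < 0.
  by rewrite -E ltNge sum_ge0.
have [re0|re_neq0] := eqVneq (map_mx re v) 0; last first.
  by rewrite ltr_nwDl ?neg_t ?q_le0.
have im_neq0 : map_mx im v != 0.
  apply: contra_neq v_neq0 => im0; apply/rowP=> l; clearbody v.
  have /rowP/(_ l) := re0; have /rowP/(_ l) := im0; rewrite !mxE => im_l re_l.
  by apply/eqP; rewrite eq_complex re_l im_l !eqxx.
by rewrite ltr_wnDl ?neg_t ?q_le0.
Qed.

End RealSpectral.

Lemma lorentzian_signs (R : realType) m (M : 'M[R]_m) :
  lorentzian M -> eigenvalue_signs M 1 (m - 1).
Proof.
move=> /lorentzian_eigenvalues[d [k0 [charM d_k0 d_lt0]]].
exists [seq d 0 k | k <- enum 'I_m]; split.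
- by rewrite big_map big_enum.
- rewrite count_map (eq_count (a2 := pred1 k0)).
    by rewrite count_uniq_mem ?enum_uniq // mem_enum.
  move=> k /=; have [->|/d_lt0] := eqVneq k k0; first by rewrite d_k0.
  exact: lt_gtF.
- rewrite count_map (eq_count (a2 := predC (pred1 k0))).
    rewrite -[in RHS](card_ord m) cardE -(count_predC (pred1 k0)).
    by rewrite count_uniq_mem ?enum_uniq // mem_enum addKn.
  move=> k /=; have [->|/d_lt0 -> //] := eqVneq k k0.
  exact: lt_gtF.
Qed.

(** * Positivity of the weighted Gram matrices *)

Section GramSquare.
Variables (R : realFieldType) (n : nat) (g : 'M[R]_n) (a : 'rV[R]_n).
Hypotheses (g_sym : g^T = g) (g_idem : g *m diag_mx a *m g = g).

(** As g is symmetric, these are its principal minors of order two. *)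
Definition gram_minors : 'M[R]_n :=
  \matrix_(i, j) (g i i * g j j - g i j * g j i).

(** Replace both factors g by g D_a g; with N = g D_x g, which is symmetric, the
    trace becomes that of D_a N D_a N. *)
Lemma trace_gram_square x :
  \tr (g *m diag_mx x *m g *m diag_mx x) =
  \sum_e \sum_f a 0 e * a 0 f * (g *m diag_mx x *m g) e f ^+ 2.
Proof.
have [N EN] : exists N, N = g *m diag_mx x *m g by eexists.
have N_sym i j : N j i = N i j.
  suff {2}<- : N^T = N by rewrite mxE.
  by rewrite EN !trmx_mul g_sym tr_diag_mx mulmxA.
transitivity (\tr (diag_mx a *m N *m diag_mx a *m N)).
  have idemr (X : 'M_n) : X *m g *m diag_mx a *m g = X *m g.
    by rewrite -[in RHS]g_idem !mulmxA.
  by rewrite EN !mulmxA [RHS]mxtrace_mulC !mulmxA g_idem idemr.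
rewrite -EN /mxtrace; apply: eq_bigr => e _; rewrite mxE; apply: eq_bigr => f _.
rewrite mul_mx_diag mul_diag_mx !mxE N_sym; ring.
Qed.

Lemma quad_form_gram_minors u : quad_form gram_minors u =
  (\sum_i u 0 i * g i i) ^+ 2 -
  \sum_e \sum_f a 0 e * a 0 f * (g *m diag_mx u *m g) e f ^+ 2.
Proof.
rewrite -trace_gram_square quad_formE expr2 /mxtrace mulr_suml -sumrB.
apply: eq_bigr => j _.
rewrite mul_mx_diag ![in RHS]mxE mulr_suml mulr_sumr -sumrB.
apply: eq_bigr => i _; rewrite mul_mx_diag !mxE; ring.
Qed.

(** The hyperplane is sum_i u_i g_ii = 0, on which only the negative sum of
    squares is left. The positive vector is a: there the form is t^2 - t, where
    t = sum_i a_i g_ii. *)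
Lemma gram_minors_lorentzian : (forall i, 0 < a 0 i) ->
  1 < \sum_i a 0 i * g i i ->
  (forall x, g *m diag_mx x *m g = 0 -> x = 0) -> lorentzian gram_minors.
Proof.
move=> a_gt0 tr_gt1 faithful; split.
- by apply/matrixP=> i j; rewrite !mxE mulrC [g j i * _]mulrC.
- exists (\col_i g i i) => u ut u_neq0.
  have {}ut : \sum_i u 0 i * g i i = 0.
    have /matrixP/(_ 0 0) := ut; rewrite !mxE => {2}<-.
    by apply: eq_bigr => i _; rewrite mxE.
  rewrite quad_form_gram_minors ut expr0n sub0r oppr_lt0.
  have term_ge0 e f : 0 <= a 0 e * a 0 f * (g *m diag_mx u *m g) e f ^+ 2.
    by rewrite mulr_ge0 ?sqr_ge0 // mulr_ge0 // ltW.
  have row_ge0 e : 0 <= \sum_f a 0 e * a 0 f * (g *m diag_mx u *m g) e f ^+ 2.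
    exact: sumr_ge0.
  rewrite lt_def sumr_ge0 // andbT; apply: contra_neq u_neq0 => sum0.
  apply: faithful; apply/matrixP=> e f; rewrite [RHS]mxE; apply/eqP.
  have /eqP := sum0; rewrite psumr_eq0 // => /allP/(_ e).
  rewrite mem_index_enum /= => /(_ isT); rewrite psumr_eq0 // => /allP/(_ f).
  rewrite mem_index_enum /= => /(_ isT).
  by rewrite mulf_eq0 sqrf_eq0 gt_eqF ?mulr_gt0.
exists a; rewrite quad_form_gram_minors g_idem.
have -> : \sum_e \sum_f a 0 e * a 0 f * g e f ^+ 2 = \sum_e a 0 e * g e e.
  apply: eq_bigr => e _; rewrite -[in RHS]g_idem mxE mulr_sumr.
  apply: eq_bigr => f _; rewrite mul_mx_diag mxE.
  have -> : g f e = g e f by rewrite -[in LHS]g_sym mxE.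
  ring.
by rewrite subr_gt0 expr2 ltr_pMl // (lt_trans ltr01).
Qed.

End GramSquare.

Section WeightedGramPositivity.
Variables (R : realFieldType) (r n : nat) (B : 'M[R]_(r, n)) (C : 'M[R]_(n, r)).
Variable a : 'rV[R]_n.
Hypotheses (BC : B *m C = 1%:M) (a_gt0 : forall i, 0 < a 0 i).

Local Notation A := (weighted_gram B a).

(** If v A = 0 then v A v^T, the sum of the a_e (v B)_e^2, vanishes; hence
    v B = 0 and v = v B C = 0. *)
Lemma weighted_gram_unit : A \in unitmx.
Proof.
rewrite unitmxE unitfE; apply/negP => /det0P[v v_neq0 vA].
have vBv : \sum_e a 0 e * (v *m B) 0 e ^+ 2 = 0.
  transitivity ((v *m A *m v^T) 0 0); last by rewrite vA mul0mx mxE.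
  rewrite /weighted_gram !mulmxA -[_ *m B^T *m _]mulmxA -trmx_mul mxE.
  apply: eq_bigr => e _; rewrite mul_mx_diag; move: (v *m B) => w.
  by rewrite !mxE expr2; ring.
have vB : v *m B = 0.
  apply/rowP=> e; rewrite [RHS]mxE; apply/eqP; rewrite -sqrf_eq0.
  have /eqP := vBv; rewrite psumr_eq0 => [|f _]; last first.
    by rewrite mulr_ge0 ?sqr_ge0 // ltW.
  by move/allP/(_ e); rewrite mem_index_enum mulf_eq0 (gt_eqF (a_gt0 e)); apply.
by case/eqP: v_neq0; rewrite -[v]mulmx1 -BC mulmxA vB mul0mx.
Qed.

End WeightedGramPositivity.

(** * The Hodge-Riemann form on linear forms *)

Section Euler.
Variables (R : realType) (n : nat).
Implicit Types (F P Q : {mpoly R[n]}) (u v : 'rV[R]_n).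

Definition linform u : {mpoly R[n]} := \sum_i u 0 i *: 'X_i.

Lemma diffop_linform u F : diffop (linform u) F = \sum_i u 0 i *: F^`M(i).
Proof.
apply: (big_ind2 (fun P Q => diffop P F = Q)) => [|P P' Q Q' <- <-|i _].
- by rewrite /diffop msupp0 big_nil.
- exact: diffopD.
- by rewrite diffopZ diffopX mderivmU1m.
Qed.

Lemma dhomog_mderiv k i F : F \is k.+1.-homog -> F^`M(i) \is k.-homog.
Proof.
move=> homF; apply/dhomogP => m; rewrite mcoeff_msupp mcoeff_mderiv => nz.
have : (m + U_(i))%MM \in msupp F.
  by rewrite mcoeff_msupp; apply: contraNneq nz => ->; rewrite mul0rn.
by move/(dhomog_mf homF); rewrite /= mdegD mdeg1 addn1 => -[].
Qed.

Lemma dhomog_diffop_linform k u F :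
  F \is k.+1.-homog -> diffop (linform u) F \is k.-homog.
Proof.
move=> homF; rewrite diffop_linform; apply: rpred_sum => i _.
by apply: rpredZ; apply: dhomog_mderiv.
Qed.

Lemma euler_homog k u F : F \is k.-homog ->
  (\sum_i u 0 i *: F^`M(i)).@[u 0] = k%:R * F.@[u 0].
Proof.
move=> homF.
have mderivE i : (F^`M(i)).@[u 0] =
    \sum_(m <- msupp F)
      F@_m * ((m i)%:R * ('X_[m - U_(i)] : {mpoly R[n]}).@[u 0]).
  rewrite {1}(mpolyE F) (raddf_sum (mderiv i)) (raddf_sum (meval _)) /=.
  by apply: eq_bigr => m _; rewrite mderivZ mevalZ mderivX mevalZ.
rewrite (raddf_sum (meval _)) /= [in RHS](mpolyE F) (raddf_sum (meval _)) /=.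
rewrite mulr_sumr.
under eq_bigr => i _ do rewrite mevalZ mderivE mulr_sumr.
rewrite exchange_big /= big_seq [RHS]big_seq; apply: eq_bigr => m m_in.
rewrite -(dhomog_mf homF m_in) /= mdegE natr_sum mulr_suml.
apply: eq_bigr => i _.
rewrite mevalZ mulrCA [RHS]mulrCA; congr (_ * _); rewrite mulrCA.
have [->|m_i] := eqVneq (m i) 0%N; first by rewrite !mul0r.
congr (_ * _); rewrite -[in RHS](@submK _ U_(i)%MM m).
  by rewrite mpolyXD mevalM mevalXU mulrC.
by apply/mnm_lepP => j; rewrite mnm1E; case: eqP => // <-; rewrite lt0n.
Qed.

(** One derivative in direction u at a time, Euler's identity contributes the
    factors k, k - 1, ..., 1. *)
Lemma diffop_linform_pow k u F : F \is k.-homog ->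
  (diffop (linform u ^+ k) F)@_0 = k`!%:R * F.@[u 0].
Proof.
elim: k F => [|k IHk] F homF.
  have -> : F = (F@_0)%:MP.
    apply/mpolyP => m; rewrite mcoeffC; have [->|m0] := eqVneq m 0%MM.
      by rewrite mulr1.
    by rewrite mulr0 (dhomog_nemf_coeff homF) ?mdeg_eq0.
  by rewrite expr0 diffop1 mevalC mcoeffC eqxx mulr1 mul1r.
rewrite exprSr diffopM IHk ?dhomog_diffop_linform //.
rewrite diffop_linform (euler_homog u homF) factS natrM; ring.
Qed.

Lemma linform_is_linear c u v :
  linform (c *: u + v) = c *: linform u + linform v.
Proof.
rewrite /linform scaler_sumr -big_split /=; apply: eq_bigr => i _.
by rewrite !mxE scalerDl scalerA.
Qed.

Lemma dhomog1P P : P \is 1.-homog -> P = linform (\row_i P@_U_(i)).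
Proof.
move=> homP; apply/mpolyP => m; rewrite raddf_sum /=.
have [/eqP/mdeg1P[i /eqP ->]|ne1] := eqVneq (mdeg m) 1%N.
  rewrite (bigD1 i) //= mcoeffZ mcoeffXU eqxx mxE mulr1 big1 ?addr0 // => j.
  by rewrite mcoeffZ mcoeffXU => /negPf ->; rewrite mulr0.
rewrite (dhomog_nemf_coeff homP) // big1 // => i _; rewrite mcoeffZ mcoeffX.
by case: eqP => [E|_]; rewrite ?mulr0 //; case/eqP: ne1; rewrite -E mdeg1.
Qed.

Lemma linform_homog u : linform u \is 1.-homog.
Proof.
apply: rpred_sum => i _; apply: rpredZ; rewrite dhomogX.
by rewrite /= mdeg1.
Qed.

Definition hessian_at F u : 'M[R]_n := \matrix_(i, j) (F^`M(i)^`M(j)).@[u 0].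

Section HodgeRiemann.
Variables (F : {mpoly R[n]}) (r : nat).
Hypotheses (homF : F \is r.-homog) (r_ge2 : (2 <= r)%N).
Local Notation A := (apolar_alg F).

Definition linclass u : A := \pi_A (linform u).

Lemma linclass_linear c u v :
  linclass (c *: u + v) = c *: linclass u + linclass v.
Proof.
rewrite /linclass linform_is_linear.
by rewrite raddfD; congr (_ + _); apply: apolar_pi_scale.
Qed.

HB.instance Definition _ :=
  GRing.isLinear.Build R 'rV[R]_n A _ linclass linclass_linear.

Lemma graded_part1P (x : A) : graded_part 1 x <-> exists u, x = linclass u.
Proof.
split=> [[P homP ->]|[u ->]]; last first.
  by exists (linform u); rewrite ?linform_homog.
by exists (\row_i P@_U_(i)); rewrite /linclass -dhomog1P.
Qed.

(** The second derivative of F in directions u and v is homogeneous of degree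
    r - 2; applying the remaining power of the linear form of a evaluates it at
    a, up to the factorial. *)
Lemma hodge_riemann1_linclass a u v :
  hodge_riemann1 r (linclass a) (linclass u) (linclass v) =
  (r - 2)`!%:R * (u *m hessian_at F a *m v^T) 0 0.
Proof.
have piM P Q : \pi_A P * \pi_A Q = \pi_A (P * Q) by rewrite apolar_pi_mul.
have piX P k : \pi_A P ^+ k = \pi_A (P ^+ k).
  elim: k => [|k IHk]; first by rewrite !expr0 piE.
  by rewrite !exprS IHk piM.
rewrite /hodge_riemann1 /linclass piX !piM apolar_deg_pi.
rewrite mulrAC mulrC diffopM diffopM.
case: r homF r_ge2 => [|[|k]] // homF' _; rewrite subSS subSS subn0.
rewrite diffop_linform_pow ?dhomog_diffop_linform //; congr (_ * _).
rewrite !diffop_linform (raddf_sum (meval _)) /= mxE.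
under [RHS]eq_bigr => j _ do rewrite mxE mulr_suml.
rewrite exchange_big; apply: eq_bigr => i _ /=.
rewrite mevalZ (raddf_sum (mderiv i)) (raddf_sum (meval _)) /= mulr_sumr.
by apply: eq_bigr => j _; rewrite mderivZ mevalZ mderiv_comm !mxE; ring.
Qed.

Variable a : 'rV[R]_n.
Hypothesis lorH : lorentzian (hessian_at F a).

Lemma linclass_nondegenerate u :
  (forall v, hodge_riemann1 r (linclass a) (linclass u) (linclass v) = 0) ->
  u = 0.
Proof.
move=> u_perp; apply: (lorentzian_nondegenerate lorH); apply/rowP => j.
rewrite [RHS]mxE; have := u_perp (delta_mx 0 j).
rewrite hodge_riemann1_linclass.
move/eqP; rewrite mulf_eq0 pnatr_eq0 -leqn0 leqNgt fact_gt0 /= => /eqP <-.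
by rewrite trmx_delta -colE [in RHS]mxE.
Qed.

(** A linear form that annihilates F is in the kernel of the Hessian. *)
Lemma linclass_inj : injective linclass.
Proof.
apply: raddf_inj => u u0; apply: linclass_nondegenerate => v.
by rewrite u0 -(raddf0 linclass) hodge_riemann1_linclass !mul0mx mxE mulr0.
Qed.

Lemma hodge_riemann1_nondegenerate :
  nondegenerate_on (graded_part 1) (hodge_riemann1 r (linclass a)).
Proof.
move=> x /graded_part1P[u ->] x_perp; rewrite (_ : u = 0) ?raddf0 //.
apply: linclass_nondegenerate => v; apply: x_perp.
by apply/graded_part1P; exists v.
Qed.

Lemma linclass_sum m (P : 'M[R]_(m, n)) (c : 'rV_m) :
  \sum_k c 0 k *: linclass (row k P) = linclass (c *m P).
Proof.
by rewrite mulmx_sum_row raddf_sum; apply: eq_bigr => k _; rewrite /= linearZ.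
Qed.

Lemma linclass_basis :
  basis_of_subspace (graded_part 1) (fun i => linclass (delta_mx 0 i)).
Proof.
have sumE (c : 'rV_n) : \sum_i c 0 i *: linclass (delta_mx 0 i) = linclass c.
  rewrite -[in RHS](mulmx1 c) -linclass_sum; apply: eq_bigr => i _.
  by rewrite row1.
split=> [i|x /graded_part1P[u ->]]; first by apply/graded_part1P; eexists.
by exists u; split=> [|c]; rewrite sumE // => /linclass_inj.
Qed.

(** The classes of the variables form a basis as well, so the matrix P of
    coordinates is invertible. It is not square by its type: that m = n is a
    consequence of the two rank conditions. *)
Lemma basis_coordinates m (e : 'I_m -> A) :
  basis_of_subspace (graded_part 1) e ->
  exists P : 'M[R]_(m, n),
  [/\ forall i, e i = linclass (row i P), row_free P & row_full P].
Proof.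
case=> e_in e_gen.
have [f Ef] := fin_all_exists (fun i => (graded_part1P _).1 (e_in i)).
exists (\matrix_i f i); set P := \matrix_i f i.
have {}Ef i : e i = linclass (row i P) by rewrite rowK.
split=> //.
  apply: inj_row_free => c cP.
  have [c0 [_ uniq_c0]] :=
    e_gen 0 ((graded_part1P _).2 (ex_intro _ 0 (esym (raddf0 linclass)))).
  rewrite -(uniq_c0 c); last first.
    by under eq_bigr => k _ do rewrite Ef; rewrite linclass_sum cP raddf0.
  by apply: uniq_c0; rewrite big1 // => k _; rewrite mxE scale0r.
have [q Eq] := fin_all_exists (fun j : 'I_n =>
  e_gen _ ((graded_part1P _).2 (ex_intro _ (delta_mx 0 j) erefl))).
apply/row_fullP; exists (\matrix_j q j); apply/row_matrixP => j.
apply: linclass_inj.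
rewrite row_mul rowK row1 -linclass_sum; have [-> _] := Eq j.
by apply: eq_bigr => k _; rewrite Ef.
Qed.

Lemma hodge_riemann1_signs :
  form_signs (graded_part 1) (hodge_riemann1 r (linclass a)) 1 (n - 1).
Proof.
split.
  by exists n, (fun i => linclass (delta_mx 0 i)); apply: linclass_basis.
move=> m e /basis_coordinates[P [Ee P_free P_full]].
have Emn : m = n by rewrite -(eqP P_free) (eqP P_full).
subst m; apply: lorentzian_signs.
have -> : gram_matrix (hodge_riemann1 r (linclass a)) e =
    (r - 2)`!%:R *: (P *m hessian_at F a *m P^T).
  apply/matrixP=> i j; rewrite [LHS]mxE !Ee hodge_riemann1_linclass [RHS]mxE.
  congr (_ * _); rewrite -row_mul mxE [RHS]mxE; apply: eq_bigr => k _.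
  by congr (_ * _); rewrite !mxE.
apply: lorentzian_scale; first by rewrite ltr0n fact_gt0.
by apply: lorentzian_congr; rewrite // -row_free_unit.
Qed.

End HodgeRiemann.
End Euler.

(** * The Hessian of the Kirchhoff polynomial *)

Section SquareFree.
Variables (R : realType) (n : nat).
Implicit Types (T : {set 'I_n}) (x : 'rV[R]_n).

Lemma prodX_mesym1 T : \prod_(k in T) 'X_k = 'X_[mesym1 T] :> {mpoly R[n]}.
Proof.
rewrite mpolyXE_id big_mkcond; apply: eq_bigr => k _; rewrite mnmE.
by case: (k \in T).
Qed.

Lemma mderiv_prodX T i :
  (\prod_(k in T) 'X_k : {mpoly R[n]})^`M(i) =
  (i \in T)%:R *: \prod_(k in T :\ i) 'X_k.
Proof.
rewrite !prodX_mesym1 mderivX mnmE.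
have [iT|_] := boolP (i \in T); last by rewrite !scale0r.
congr (_ *: 'X_[_]); apply/mnmP => k; rewrite mnmBE mnm1E !mnmE in_setD1.
by have [<-|] := eqVneq i k; rewrite ?iT ?subn0 // eq_sym => /negPf ->.
Qed.

(** A square-free monomial is affine in each variable. *)
Lemma prodX_difference T x i :
  (\prod_(k in T) 'X_k : {mpoly R[n]})^`M(i).@[x 0] =
  (\prod_(k in T) 'X_k : {mpoly R[n]}).@[(x + delta_mx 0 i) 0]
  - (\prod_(k in T) 'X_k : {mpoly R[n]}).@[x 0].
Proof.
rewrite mderiv_prodX mevalZ !rmorph_prod /=.
have other k : k != i -> ('X_k : {mpoly R[n]}).@[(x + delta_mx 0 i) 0] =
    ('X_k : {mpoly R[n]}).@[x 0].
  by move=> /negPf ne; rewrite !mevalXU !mxE ne addr0.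
have [iT|iT] := boolP (i \in T); last first.
  rewrite mul0r; apply/esym/eqP; rewrite subr_eq0; apply/eqP/eq_bigr => k kT.
  by apply: other; apply: contraNneq iT => <-.
rewrite mul1r !(big_setD1 i iT) /=.
rewrite [X in _ = _ * X - _](eq_bigr (fun k => ('X_k : {mpoly R[n]}).@[x 0])).
  by rewrite !mevalXU !mxE !eqxx mulrDl mul1r addrAC subrr add0r.
by move=> k /setD1P[ne _]; apply: other.
Qed.

Variable (P : pred {set 'I_n}).
Local Notation F :=
  (\sum_(T : {set 'I_n} | P T) \prod_(k in T) 'X_k : {mpoly R[n]}).

Lemma hessian_at_square_free x i j : let d k : 'rV[R]_n := delta_mx 0 k in
  hessian_at F x i j =
  F.@[(x + d i + d j) 0] - F.@[(x + d i) 0] - F.@[(x + d j) 0] + F.@[x 0].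
Proof.
move=> d; rewrite mxE (raddf_sum (mderiv i)) (raddf_sum (mderiv j)) /=.
rewrite !(raddf_sum (meval _)) /= -!sumrB -big_split /=; apply: eq_bigr => T _.
rewrite {1}mderiv_prodX mderivZ mevalZ prodX_difference mulrBr -!mevalZ.
rewrite -mderiv_prodX.
by rewrite !prodX_difference -/(d i) -/(d j) [x + d j + d i]addrAC; ring.
Qed.

End SquareFree.

Section KirchhoffHessian.
Variables (R : realType) (V : finType) (r n : nat) (G : sgraph V n).
Hypothesis hV : #|V| = r.+1.
Local Notation B := (incidence G hV R).

Lemma kirchhoff_homog : kirchhoff G R \is r.-homog.
Proof.
apply: rpred_sum => T; rewrite (spanning_treeE G hV) => /andP[_ /eqP <-].
by rewrite prodX_mesym1 dhomogX /= mdeg_mesym1.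
Qed.

Lemma kirchhoff_eval (x : 'rV[R]_n) :
  (kirchhoff G R).@[x 0] = \det (weighted_gram B x).
Proof.
rewrite weighted_matrix_tree (raddf_sum (meval _)) /=; apply: eq_bigr => T _.
by rewrite rmorph_prod; apply: eq_bigr => i _; rewrite /= mevalXU.
Qed.

(** Pair the matrix with the indicators of the two ends of e: only an edge that
    meets both ends contributes, and in a simple graph this is e alone, with
    value - x_e. *)
Lemma incidence_gram_inj (x : 'rV[R]_n) : weighted_gram B x = 0 -> x = 0.
Proof.
move=> x0; apply/rowP=> e; rewrite [RHS]mxE.
pose at_ (v w : V) : R := (w == v)%:R.
have : (potential hV (at_ (src G e)) *m weighted_gram B x *m
        (potential hV (at_ (tgt G e)))^T) 0 0 = 0.
  by rewrite x0 mulmx0 mul0mx mxE.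
rewrite /weighted_gram !mulmxA -[_ *m B^T *m _]mulmxA -trmx_mul mxE.
rewrite (bigD1 e) //=.
rewrite big1 ?addr0; last first.
  move=> f ne_fe; rewrite mul_mx_diag mxE [(_^T) _ _]mxE.
  rewrite !potential_incidence.
  have off v : v \notin G f -> at_ v (src G f) - at_ v (tgt G f) = 0.
    rewrite edge_ends in_set2 negb_or /at_ => /andP[/negPf n1 /negPf n2].
    by rewrite [src G f == v]eq_sym [tgt G f == v]eq_sym n1 n2 subrr.
  have [s_f|/off ->] := boolP (src G e \in G f); last by rewrite !mul0r.
  have [t_f|/off ->] := boolP (tgt G e \in G f); last by rewrite mulr0.
  case/eqP: ne_fe; apply/esym/(@edge_inj _ _ G)/eqP.
  rewrite eqEcard !edge_card leqnn andbT (edge_ends G e).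
  by rewrite subUset !sub1set s_f t_f.
rewrite mul_mx_diag mxE [(_^T) _ _]mxE !potential_incidence /at_ !eqxx.
rewrite [tgt G e == _]eq_sym (negPf (src_neq_tgt G e)) subr0 sub0r mul1r mulrN1.
by move/eqP; rewrite oppr_eq0 => /eqP.
Qed.

Lemma kirchhoff_hessian_lorentzian (a : 'rV[R]_n) :
  (2 <= r)%N -> connected_graph G -> (forall i, 0 < a 0 i) ->
  lorentzian (hessian_at (kirchhoff G R) a).
Proof.
move=> r_ge2 conG a_gt0.
have [C BC] := connected_incidence_rinv hV R conG.
rewrite -mulmxA in BC.
have unitA := weighted_gram_unit BC a_gt0.
have detA_gt0 : 0 < \det (weighted_gram B a).
  rewrite lt_def; apply/andP; split; first by rewrite -unitfE -unitmxE.
  rewrite weighted_matrix_tree; apply: sumr_ge0 => T _; apply: prodr_ge0 => i _.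
  exact: ltW.
have -> : hessian_at (kirchhoff G R) a =
    \det (weighted_gram B a) *: gram_minors (effective_gram B a).
  apply/matrixP=> i j; rewrite hessian_at_square_free -/(kirchhoff G R).
  rewrite !kirchhoff_eval.
  by rewrite mixed_difference_det_weighted_gram // !mxE.
apply: lorentzian_scale => //; apply: (@gram_minors_lorentzian _ _ _ a) => //.
- exact: effective_gram_tr.
- exact: effective_gram_idem.
- by rewrite effective_gram_trace // ltr1n.
- by move=> x; apply: (effective_gram_faithful unitA BC incidence_gram_inj).
Qed.

End KirchhoffHessian.

Theorem theorem1p3 (R : realType) (V : finType) (r n : nat) (G : sgraph V n)
    (hr : (2 <= r)%N) (hV : #|V| = r.+1) (hG : connected_graph G)
    (a : 'I_n -> R) (ha : forall i, 0 < a i) :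
  let F := kirchhoff G R in
  let L := \pi_(apolar_alg F) (\sum_i a i *: 'X_i) in
  nondegenerate_on (graded_part 1%N) (hodge_riemann1 r L) /\
  form_signs (graded_part 1%N) (hodge_riemann1 r L) 1%N (n - 1)%N.
Proof.
move=> F L; pose u : 'rV[R]_n := \row_i a i.
have -> : L = linclass F u.
  by congr (\pi_(apolar_alg F) _); apply: eq_bigr => i _; rewrite mxE.
have homF : F \is r.-homog := kirchhoff_homog R G hV.
have lorF : lorentzian (hessian_at F u).
  by apply: (kirchhoff_hessian_lorentzian hV hr hG) => i; rewrite mxE.
split; first exact: hodge_riemann1_nondegenerate.
exact: hodge_riemann1_signs.
Qed.
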